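(* Let $G$ be a group with a malnormal subgroup $A$ and an involution $t\in G\setminus A$, such that $A$ contains no involutions. Then for any two elements $u,v\in G$ with $Au\neq Av$ there exist (a) a group $G_1$ containing $G$ as a subgroup (an extension $G\le G_1$); (b) a malnormal subgroup $A_1$ of $G_1$ such that $A_1$ does not contain involutions and $A_1\cap G=A$; (c) an element $f\in G_1$ such that $A_1f=A_1u$ and $A_1tf=A_1v$.
   Context: A proper subgroup $A$ of a group $G$ is called malnormal in $G$ if $A\cap g^{-1}Ag=1$ for all $g\in G\setminus A$ (the trivial subgroup is allowed when it is proper). An involution is an element of order exactly $2$. An ''extension'' $G\le G_1$ means that $G_1$ is a group having $G$ as a subgroup. $Ag$ denotes a right coset. *)

(* Defs.v *)
From mathcomp Require Import all_boot.
From mathcomp Require Import boolp classical_sets.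

Set Implicit Arguments.
Unset Strict Implicit.
Unset Printing Implicit Defensive.

Local Open Scope classical_set_scope.
Local Open Scope group_scope.

(* [groupType] carries a choice structure; under the classical axioms of
   [boolp] every type has one ([gen_eqMixin], [gen_choiceMixin]), so the groups
   below are arbitrary, possibly infinite, groups. *)

Definition subgroup (G : groupType) (A : set G) : Prop := group_closed [in A].

Definition right_coset (G : groupType) (A : set G) (g : G) : set G :=
  [set a * g | a in A].

(* In MathComp, [a ^ g] is [g^-1 * (a * g)]. *)
Definition conj_set (G : groupType) (A : set G) (g : G) : set G :=
  [set a ^ g | a in A].

Definition malnormal (G : groupType) (A : set G) : Prop :=
  [/\ subgroup A, A `<` [set: G] &
      forall g : G, ~ A g -> A `&` conj_set A g = [set 1]].

Definition involution (G : groupType) (t : G) : Prop :=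
  t <> 1 /\ t ^+ 2 = 1.

Definition involution_free (G : groupType) (A : set G) : Prop :=
  forall a : G, A a -> ~ involution a.

(* Main.v *)
Require Import Defs.
From HB Require Import structures.
From mathcomp Require Import all_boot.
From mathcomp Require Import boolp classical_sets.

Set Implicit Arguments.
Unset Strict Implicit.
Unset Printing Implicit Defensive.

Local Open Scope classical_set_scope.
Local Open Scope group_scope.

(** Malnormality is a statement about fixed points: a proper subgroup A is
    malnormal and free of involutions exactly when, in the action of G on the
    right cosets of A, a nontrivial element fixes at most one point and an
    involution fixes none.  Such actions are called rigid below.  The stabilizer
    of a point that is moved by some element of a rigid action is malnormal and
    free of involutions, so it is enough to embed G and its coset space X
    equivariantly into a rigid action of a larger group in which some f sends
    the coset A to A u and A t to A v ([rigid_extension]).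

    If an element of G already does this, nothing has to be added.  Otherwise
    f is prescribed on the two points of X only, and G and f are made to act on
    a larger set Y in the freest possible way: whenever f or its inverse has to
    be applied to a point where it has no value yet, a fresh free G-orbit is
    attached.  One relation is forced: if some s in G exchanges A u and A v,
    then f^-1 t f and s agree at two points and so must be equal.  In that case
    f is completed equivariantly for <t> and <s>, which makes the group
    generated by G and f an HNN extension; in the other case it is the free
    product of G and <f>.  Here G1 is simply the permutation group of Y
    generated by G and f, so no normal form theorem is needed.

    The orbits of Y form a tree hanging from X, and the depth in this tree
    controls everything.  Up to conjugation an element outside the conjugates
    of G is given by a cyclically reduced word.  Once the path that such a word
    traces from a point goes up, it goes up forever ([ascent]).  Hence a closed
    path of such a word never leaves X, where f is the prescribed pair of values
    ([flat_first]).  If two points are fixed, the elements of G between the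
    letters f and f^-1 of the word map the pairs {A, A t} and {A u, A v} to
    each other; as no element of G links the two pairs, the signs alternate,
    and an element preserving {A u, A v} can be cancelled, contrary to
    reducedness ([cycle_fix1]).  Finally, a cyclically reduced word never has
    order two, since some point starts an ascent
    ([cycle_not_involution]). *)

(** * Rigid maps and rigid actions *)

Definition is_action (G : groupType) (X : Type) (act : X -> G -> X) : Prop :=
  (forall x, act x 1 = x) /\ (forall x g h, act x (g * h) = act (act x g) h).

(** The two alternatives in the premise express at once that a nontrivial map
    fixes at most one point and that an involution fixes none. *)
Definition rigid_map (X : Type) (p : X -> X) : Prop :=
  forall x, p x = x ->
    (exists2 y, y <> x & p y = y) \/ (forall y, p (p y) = y) ->
    forall y, p y = y.

Definition rigid_action (G : groupType) (X : Type) (act : X -> G -> X) : Prop :=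
  forall x g, act x g = x -> (exists2 y, y <> x & act y g = y) \/ g * g = 1 ->
  g = 1.

(** Rigidity is invariant under conjugation; this is what allows words to be
    rotated and cyclically reduced. *)
Lemma rigid_conj (X : Type) (c d p q : X -> X) :
  cancel c d -> cancel d c -> (forall x, q (c x) = c (p x)) ->
  rigid_map q -> rigid_map p.
Proof.
move=> cK dK qc rq x px H y.
suff: q (c y) = c y by rewrite qc => /(can_inj cK).
apply: (rq (c x)); first by rewrite qc px.
case: H => [[z zx pz]|pp]; [left|right].
  by exists (c z); [move=> /(can_inj cK)|rewrite qc pz].
by move=> z; rewrite -(dK z) !qc pp.
Qed.

(** The map [h] marks one point in each orbit of [i].  When an orbit under a
    relation is to share a new edge, the marked point will name that edge. *)
Lemma exists_half (Z : Type) (i : Z -> Z) :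
  involutive i -> (forall z, i z <> z) ->
  exists h : Z -> bool, forall z, h (i z) = ~~ h z.
Proof.
move=> iK i_free.
pose orb z : pred {classic Z} := fun w => `[< w = z \/ w = i z >].
have orbz z : orb z z by apply/asboolP; left.
have orbi z : orb z =1 orb (i z).
  by move=> w; apply/asboolP/asboolP; rewrite iK; tauto.
have rep z : choose (orb (i z)) (i z) = choose (orb z) z.
  rewrite -(eq_choose (orbi z)); apply: choose_id => //.
  by rewrite orbi.
exists (fun z => `[< choose (orb z) z = z >]) => z; rewrite rep.
have : orb z (choose (orb z) z) by exact: chooseP.
move: (choose _ _) => r /asboolP[->|->].
  by rewrite [in RHS]asboolT // asboolF // => /esym/i_free.
by rewrite asboolT // asboolF //; exact: i_free.
Qed.

(** * The permutation group generated by a family *)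

(** Closing the index set under inverses makes the words closed under inverses,
    and no exponents are needed. *)
Record perm_family (X : Type) := PermFamily {
  pf_index : Type;
  pf_map : pf_index -> X -> X;
  pf_inv : pf_index -> pf_index;
  pf_mapK : forall i, cancel (pf_map i) (pf_map (pf_inv i));
  pf_mapVK : forall i, cancel (pf_map (pf_inv i)) (pf_map i) }.

Section GeneratedGroup.
Variables (X : Type) (F : perm_family X).

Definition run (w : seq (pf_index F)) (x : X) : X :=
  foldl (fun y i => pf_map i y) x w.

Definition run_inv (w : seq (pf_index F)) := rev (map (@pf_inv _ F) w).

Lemma run_cat w1 w2 x : run (w1 ++ w2) x = run w2 (run w1 x).
Proof. exact: foldl_cat. Qed.

Lemma run_inv_cons i w : run_inv (i :: w) = run_inv w ++ [:: pf_inv i].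
Proof. by rewrite /run_inv /= rev_cons -cats1. Qed.

Lemma runK w : cancel (run w) (run (run_inv w)).
Proof.
elim: w => [//|i w IH] x; rewrite run_inv_cons run_cat.
by rewrite -[run (i :: w) x]/(run w (pf_map i x)) IH; exact: pf_mapK.
Qed.

Lemma runVK w : cancel (run (run_inv w)) (run w).
Proof.
elim: w => [//|i w IH] x; rewrite run_inv_cons run_cat.
rewrite -[run (i :: w) _]/(run w (pf_map i (pf_map (pf_inv i) _))).
by rewrite pf_mapVK IH.
Qed.

Record generated := Generated {
  gen_map :> X -> X;
  gen_word : exists w, gen_map = run w }.

HB.instance Definition _ := gen_eqMixin generated.
HB.instance Definition _ := gen_choiceMixin generated.

Lemma generated_eq (p q : generated) : p =1 q -> p = q.
Proof.
case: p q => [p pw] [q qw] /= /funext pq; case: _ / pq in qw *.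
by congr Generated; exact: Prop_irrelevance.
Qed.

Definition word (p : generated) := sval (cid (gen_word p)).

Lemma wordE (p : generated) : gen_map p = run (word p).
Proof. exact: (svalP (cid (gen_word p))). Qed.

Definition of_word w : generated := Generated (ex_intro _ w erefl).

Definition generated_mul (p q : generated) := of_word (word p ++ word q).

Lemma generated_mulE p q x : generated_mul p q x = q (p x).
Proof. by rewrite /= run_cat -!wordE. Qed.

Definition generated_inv (p : generated) := of_word (run_inv (word p)).

Lemma generated_mulA : associative generated_mul.
Proof. by move=> p q r; apply: generated_eq => x; rewrite !generated_mulE. Qed.

Lemma generated_mul1 : left_id (of_word [::]) generated_mul.
Proof. by move=> p; apply: generated_eq => x; rewrite !generated_mulE. Qed.

Lemma generated_mulr1 : right_id (of_word [::]) generated_mul.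
Proof. by move=> p; apply: generated_eq => x; rewrite !generated_mulE. Qed.

Lemma generated_mulV : left_inverse (of_word [::]) generated_inv generated_mul.
Proof.
by move=> p; apply: generated_eq => x; rewrite !generated_mulE wordE runVK.
Qed.

Lemma generated_mulrV :
  right_inverse (of_word [::]) generated_inv generated_mul.
Proof.
by move=> p; apply: generated_eq => x; rewrite generated_mulE (wordE p) /= runK.
Qed.

HB.instance Definition _ := isGroup.Build generated generated_mulA
  generated_mul1 generated_mulr1 generated_mulV generated_mulrV.

Lemma generated_action : is_action (fun x (p : generated) => p x).
Proof. by split=> // x p q; rewrite generated_mulE. Qed.

(** The elements of [generated F] are all words in [F], so rigidity of the
    action has to be checked on words only. *)
Lemma generated_rigid :
  (forall w, rigid_map (run w)) ->
  rigid_action (fun x (p : generated) => p x).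
Proof.
move=> rig x p px H; apply: generated_eq.
rewrite wordE; apply: (rig _ x); rewrite -wordE //.
case: H => [|pp]; [by left|right] => y.
by rewrite -generated_mulE -[generated_mul p p]/(p * p) pp.
Qed.

End GeneratedGroup.

(** * The free completion of a partial bijection

    The letter [true] stands for f and [false] for its inverse.  The letter [e]
    is prescribed at the two points [base e true] and [base e false], which it
    sends to [base (~~ e) true] and [base (~~ e) false].  The relation imposed
    on f is that it intertwines [tau true] and [tau false]; both are
    involutions, or both are trivial and then no relation is imposed.
    [base_stab] speaks of the pair of [false] only, because in the application
    the pair of [true] is exchanged by t whether or not there is a relation. *)

Section FreeCompletion.
Variables (G : groupType) (X : Type) (act : X -> G -> X).
Hypotheses (actP : is_action act) (act_rigid : rigid_action act).
Variables (tau : bool -> G) (base : bool -> bool -> X).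
Hypothesis tau2 : forall e, tau e * tau e = 1.
Hypothesis tau1 : forall e, tau e = 1 -> tau (~~ e) = 1.
Hypothesis base_neq : forall e, base e true <> base e false.
Hypothesis base_tau :
  forall e i, tau e <> 1 -> act (base e i) (tau e) = base e (~~ i).
Hypothesis base_unlinked :
  forall g, ~ forall i, exists j, act (base true i) g = base false j.
Hypothesis base_stab : forall g,
  (forall i, exists j, act (base false i) g = base false j) ->
  g = 1 \/ g = tau false.

(** [slot e] is the subgroup {1, tau e} and [transfer e] the isomorphism from
    it to [slot (~~ e)] that passing through the letter [e] induces. *)
Definition slot e : pred G := [pred g | (g == 1) || (g == tau e)].

Definition transfer (e : bool) (g : G) : G := if g == 1 then 1 else tau (~~ e).

Lemma slot1 e : slot e 1. Proof. by rewrite /slot /= eqxx. Qed.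

Lemma slot_tau e : slot e (tau e). Proof. by rewrite /slot /= eqxx orbT. Qed.

Lemma slotM e g h : slot e g -> slot e h -> slot e (g * h).
Proof.
by move=> /orP[]/eqP-> /orP[]/eqP->;
  rewrite ?mul1g ?mulg1 ?tau2 /slot /= eqxx ?orbT.
Qed.

Lemma slot_inv e g : slot e g -> g * g = 1.
Proof. by case/orP=> /eqP->; rewrite ?mul1g. Qed.

Lemma transfer1 e : transfer e 1 = 1. Proof. by rewrite /transfer eqxx. Qed.

Lemma transfer_tau e : transfer e (tau e) = tau (~~ e).
Proof. by rewrite /transfer; case: eqP => // /tau1->. Qed.

Lemma slot_transfer e g : slot (~~ e) (transfer e g).
Proof. by rewrite /transfer; case: eqP => _; rewrite ?slot1 ?slot_tau. Qed.

Lemma transferK e g : slot e g -> transfer (~~ e) (transfer e g) = g.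
Proof.
case/orP=> /eqP->; first by rewrite !transfer1.
by rewrite !transfer_tau negbK.
Qed.

Lemma transferM e g h : slot e g -> slot e h ->
  transfer e (g * h) = transfer e g * transfer e h.
Proof.
by case/orP=> /eqP-> /orP[]/eqP->;
  rewrite ?mul1g ?mulg1 ?tau2 ?transfer1 ?transfer_tau ?mul1g ?mulg1 ?tau2.
Qed.

(** [node y e g] is the point reached from [y] by the letter [e] followed by
    [g]. *)
Inductive tree := core of X | node of tree & bool & G.

Fixpoint depth z : nat := if z is node y _ _ then (depth y).+1 else 0.

Definition tact z g : tree :=
  match z with core x => core (act x g) | node y e h => node y e (h * g) end.

Lemma tact1 z : tact z 1 = z.
Proof. by case: z => [x|y e h] /=; rewrite ?mulg1 // (proj1 actP). Qed.

Lemma tactM z g h : tact z (g * h) = tact (tact z g) h.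
Proof. by case: z => [x|y e k] /=; rewrite ?mulgA // (proj2 actP). Qed.

Lemma depth_tact z g : depth (tact z g) = depth z.
Proof. by case: z. Qed.

Lemma tact_free z g :
  tact z g = z -> g = 1 \/ exists2 x, z = core x & act x g = x.
Proof.
case: z => [x|y e h] /= [E]; first by right; exists x.
by left; apply: (mulgI h); rewrite mulg1.
Qed.

(** The relation subgroup [slot e] acts freely, even on [X], since involutions
    have no fixed point in a rigid action. *)
Lemma tact_tau z e : tau e <> 1 -> tact z (tau e) <> z.
Proof.
move=> t1 /tact_free[//|[x _ xt]]; apply: t1.
by apply: (act_rigid xt); right.
Qed.

Lemma chosen_exists e : exists h : tree -> bool,
  forall z, tau e = 1 /\ h z \/ tau e <> 1 /\ h (tact z (tau e)) = ~~ h z.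
Proof.
have [t1|t1] := pselect (tau e = 1); first by exists xpredT => z; left.
have [||h hP] := @exists_half tree (fun z => tact z (tau e)).
- by move=> z; rewrite -tactM tau2 tact1.
- by move=> z; exact: tact_tau.
by exists h => z; right.
Qed.

(** A transversal of the [tau e]-orbits.  The points [z] and [tact z (tau e)]
    must share the orbit attached for the letter [e], which is therefore named
    after the chosen one of the two. *)
Definition chosen e : tree -> bool := sval (cid (chosen_exists e)).

Lemma chosen_tau e z : ~~ chosen e z ->
  [/\ tau e <> 1, chosen e (tact z (tau e)) & tau (~~ e) <> 1].
Proof.
move=> nz; have := svalP (cid (chosen_exists e)) z.
rewrite -[sval _]/(chosen e) => -[[_ cz]|[t1 ->]]; first by rewrite cz in nz.
by split=> // /tau1; rewrite negbK.
Qed.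

Lemma chosenN e z : tau e <> 1 -> chosen e z -> ~~ chosen e (tact z (tau e)).
Proof.
move=> t1 cz; have := svalP (cid (chosen_exists e)) z.
by rewrite -[sval _]/(chosen e) cz => -[[]//|[_ ->]].
Qed.

(** The value of the letter [e] at [z] when it is known before anything is
    attached to [z]: at the base points, and on the edge by which the orbit of
    [z] is attached. *)
Definition prescribed e z : option tree :=
  match z with
  | core x => if `[< x = base e true >] then Some (core (base (~~ e) true)) else
              if `[< x = base e false >] then Some (core (base (~~ e) false))
              else None
  | node y e' g =>
      if (e' == ~~ e) && slot e g then Some (tact y (transfer e g)) else None
  end.

(** If [z] is not chosen, its mate [z'] is; from [z] = [tact z' (tau e)] and the
    relation, the value at [z] is that at [z'] followed by [tau (~~ e)]. *)
Definition jump e z : tree :=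
  if prescribed e z is Some y then y else
  if chosen e z then node z e 1 else node (tact z (tau e)) e (tau (~~ e)).

Lemma prescribed_core e i :
  prescribed e (core (base e i)) = Some (core (base (~~ e) i)).
Proof.
case: i => /=; first by rewrite asboolT.
by rewrite asboolF ?asboolT // => /esym/base_neq.
Qed.

Lemma prescribed_coreP e x y : prescribed e (core x) = Some y ->
  exists2 i, x = base e i & y = core (base (~~ e) i).
Proof.
rewrite /=; case: asboolP => [-> [<-]|_]; first by exists true.
by case: asboolP => // -> [<-]; exists false.
Qed.

Lemma prescribed_tau_Some e z y : prescribed e z = Some y ->
  prescribed e (tact z (tau e)) = Some (tact y (tau (~~ e))).
Proof.
have [t1|t1] := pselect (tau e = 1); first by rewrite t1 (tau1 t1) !tact1.
have t1' : tau (~~ e) <> 1 by move=> /tau1; rewrite negbK.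
case: z => [x /prescribed_coreP[i -> ->]|y' e' g].
  by rewrite /tact !base_tau // prescribed_core.
rewrite /=; case: ifP => // /andP[/eqP-> sg] [<-].
rewrite eqxx slotM ?slot_tau //=.
by rewrite transferM ?slot_tau // transfer_tau tactM.
Qed.

(** Being prescribed is a property of the [tau e]-orbit. *)
Lemma prescribed_tau e z :
  prescribed e (tact z (tau e)) = omap (tact^~ (tau (~~ e))) (prescribed e z).
Proof.
case E: (prescribed e z) => [y|] /=; first exact: prescribed_tau_Some.
case E': (prescribed _ _) => [y|//]; move/prescribed_tau_Some: E'.
by rewrite -tactM tau2 tact1 E.
Qed.

Lemma jump_tau e z : jump e (tact z (tau e)) = tact (jump e z) (tau (~~ e)).
Proof.
have [t1|t1] := pselect (tau e = 1); first by rewrite t1 (tau1 t1) !tact1.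
rewrite /jump prescribed_tau; case: (prescribed e z) => [//|] /=.
have [cz|ncz] := boolP (chosen e z).
  by rewrite (negbTE (chosenN t1 cz)) -tactM tau2 tact1 /= mul1g.
by have [_ -> _] := chosen_tau ncz; rewrite /= tau2.
Qed.

(** The relation: [g] followed by the letter [e] equals [e] followed by
    [transfer e g]. *)
Lemma jump_slot e z g : slot e g ->
  jump e (tact z g) = tact (jump e z) (transfer e g).
Proof.
case/orP=> /eqP->; first by rewrite transfer1 !tact1.
by rewrite transfer_tau jump_tau.
Qed.

(** A new orbit is attached only once per relation orbit and only where the
    letter has no value yet; outside these trees [jump e] is not injective. *)
Fixpoint valid z : bool :=
  if z is node y e _ then [&& valid y, chosen e y & ~~ prescribed e y]
  else true.

Lemma valid_tact z g : valid (tact z g) = valid z.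
Proof. by case: z. Qed.

Lemma valid_jump e z : valid z -> valid (jump e z).
Proof.
rewrite /jump; case E: (prescribed e z) => [y|].
  case: z E => [x /prescribed_coreP[i _ ->] //|y' e' g] /=.
  by case: ifP => // _ [<-] /and3P[vy _ _]; rewrite valid_tact.
have [cz vz|ncz vz] := boolP (chosen e z); first by rewrite /= vz cz E.
have [_ cz _] := chosen_tau ncz.
by rewrite /= valid_tact vz cz prescribed_tau E.
Qed.

Lemma jumpK e z : valid z -> jump (~~ e) (jump e z) = z.
Proof.
have jump_node y g e' : slot e' g ->
    jump e' (node y (~~ e') g) = tact y (transfer e' g).
  by move=> sg; rewrite /jump /= eqxx sg.
case E: (prescribed e z) => [y|] vz.
  have -> : jump e z = y by rewrite /jump E.
  case: z E vz => [x /prescribed_coreP[i -> ->] _|y' e' g].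
    by rewrite /jump prescribed_core negbK.
  rewrite /=; case: ifP => // /andP[/eqP-> sg] [<-] /and3P[_ cy xy].
  rewrite jump_slot ?slot_transfer // transferK // /jump.
  by case: (prescribed _ y') xy => //; rewrite cy /= mul1g.
have sK g : slot e g -> tact (tact z g) g = z.
  by move=> sg; rewrite -tactM (slot_inv sg) tact1.
have {}jump_node y g : slot (~~ e) g ->
    jump (~~ e) (node y e g) = tact y (transfer (~~ e) g).
  by move=> sg; rewrite -{2}(negbK e) jump_node.
rewrite {2}/jump E; have [cz|ncz] := boolP (chosen e z).
  by rewrite jump_node ?slot1 // transfer1 tact1.
by rewrite jump_node ?slot_tau // transfer_tau negbK sK // slot_tau.
Qed.

Lemma jumpVK e z : valid z -> jump e (jump (~~ e) z) = z.
Proof. by move=> /(jumpK (~~ e)); rewrite negbK. Qed.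

Lemma jump_core e i : jump e (core (base e i)) = core (base (~~ e) i).
Proof. by rewrite /jump prescribed_core. Qed.

(** Away from the base points each letter changes the depth by one. *)
Lemma jump_flat e z : depth (jump e z) = depth z ->
  exists i, z = core (base e i).
Proof.
rewrite /jump; case E: (prescribed e z) => [y|]; last first.
  by case: ifP => _ /eqP; rewrite /= ?depth_tact gtn_eqF.
case: z E => [x /prescribed_coreP[i -> _] _|y' e' g] /=; first by exists i.
by case: ifP => // _ [<-] /eqP; rewrite depth_tact ltn_eqF.
Qed.

(** An orbit is attached by a single edge, so from it the only ways down are
    those that undo the step that led there. *)
Lemma jump_up e e' z g :
  depth z < depth (jump e z) ->
  ~~ ((e' == ~~ e) && slot e' g) ->
  depth (jump e z) < depth (jump e' (tact (jump e z) g)).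
Proof.
case E: (prescribed e z) => [y|] up nr.
  move: up; rewrite /jump E {nr}.
  case: z E => [x /prescribed_coreP[i _ ->] //|y' e1 h].
  by rewrite /=; case: ifP => // _ [<-]; rewrite depth_tact ltnNge leqnSn.
have [y [h [sh ->]]] : exists y h, slot (~~ e) h /\ jump e z = node y e h.
  rewrite /jump E; case: ifP => _; first by exists z, 1; rewrite slot1.
  by exists (tact z (tau e)), (tau (~~ e)); rewrite slot_tau.
suff /negbTE nh : ~~ ((e == ~~ e') && slot e' (h * g)).
  rewrite /jump [prescribed _ _]/= nh.
  by case: ifP => _ //=; rewrite depth_tact.
apply: contra nr => /andP[/eqP E' shg]; rewrite -(negbK e') -E' eqxx /=.
move: sh shg; rewrite E' negbK => sh shg.
by rewrite -[g]mul1g -(slot_inv sh) -mulgA slotM.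
Qed.

(** * Words and their paths *)

Definition point := {z : tree | valid z}.

Definition pcore x : point := exist _ (core x) isT.

Definition pact (z : point) g : point :=
  exist _ (tact (val z) g) (etrans (valid_tact _ _) (valP z)).

Definition pjump e (z : point) : point :=
  exist _ (jump e (val z)) (valid_jump e (valP z)).

Lemma pactP : is_action pact.
Proof. by split=> [z|z g h]; apply: val_inj; rewrite /= ?tact1 ?tactM. Qed.

Lemma pact_core x g : pact (pcore x) g = pcore (act x g).
Proof. exact: val_inj. Qed.

Lemma pactK g : cancel (pact^~ g) (pact^~ g^-1).
Proof. by move=> z; rewrite -(proj2 pactP) mulgV (proj1 pactP). Qed.

Lemma pactVK g : cancel (pact^~ g^-1) (pact^~ g).
Proof. by move=> z; rewrite -(proj2 pactP) mulVg (proj1 pactP). Qed.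

Lemma pjumpK e : cancel (pjump e) (pjump (~~ e)).
Proof. by move=> z; apply: val_inj; rewrite /= jumpK // (valP z). Qed.

Lemma pjumpVK e : cancel (pjump (~~ e)) (pjump e).
Proof. by move=> z; apply: val_inj; rewrite /= jumpVK // (valP z). Qed.

Lemma pjump_core e i : pjump e (pcore (base e i)) = pcore (base (~~ e) i).
Proof. by apply: val_inj; rewrite /= jump_core. Qed.

Lemma pjump_slot e z g : slot e g ->
  pjump e (pact z g) = pact (pjump e z) (transfer e g).
Proof. by move=> sg; apply: val_inj; rewrite /= jump_slot. Qed.

Definition level (z : point) := depth (val z).

Lemma level_act z g : level (pact z g) = level z.
Proof. exact: depth_tact. Qed.

(** A pair [(g, e)] means: first apply [g], then the letter [e].  Up to
    conjugation, every product of elements of G and letters is a sequence of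
    such pairs or a single element of G. *)
Definition letter := (G * bool)%type.

Definition step (a : letter) (z : point) : point := pjump a.2 (pact z a.1).

Definition ev (l : seq letter) (z : point) : point :=
  foldl (fun y a => step a y) z l.

(** [e] followed by an element of [slot (~~ e)] and the letter [~~ e] can be
    replaced by an element of G; reduced words exclude this. *)
Definition reduced : rel letter :=
  [rel a b | ~~ ((b.2 == ~~ a.2) && slot b.2 b.1)].

Lemma reducedxx a : reduced a a.
Proof. by rewrite /reduced /=; case: a.2. Qed.

Lemma ev_cat l1 l2 z : ev (l1 ++ l2) z = ev l2 (ev l1 z).
Proof. exact: foldl_cat. Qed.

Lemma ev_bij l : exists c, cancel (ev l) c /\ cancel c (ev l).
Proof.
elim: l => [|[g e] l [c [lK cK]]]; first by exists id.
exists (fun z => pact (pjump (~~ e) (c z)) g^-1); split=> z.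
  by rewrite -[ev _ _]/(ev l (step (g, e) z)) lK /step /= pjumpK pactK.
rewrite -[ev _ _]/(ev l (step (g, e) _)) /step /=.
by rewrite [pact (pact _ _) _]pactVK pjumpVK cK.
Qed.

Lemma rigid_ev_rotate l1 l2 :
  rigid_map (ev (l2 ++ l1)) -> rigid_map (ev (l1 ++ l2)).
Proof.
have [c [cK Kc]] := ev_bij l1.
by apply: (rigid_conj cK Kc) => z; rewrite !ev_cat.
Qed.

Lemma level_step a z :
  level z < level (step a z) ->
  depth (tact (val z) a.1) < depth (jump a.2 (tact (val z) a.1)).
Proof. by rewrite depth_tact. Qed.

(** By [jump_up] the path of a reduced word can never turn down again. *)
Lemma ascent a l z : level z < level (step a z) -> path reduced a l ->
  level z < level (ev (a :: l) z).
Proof.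
elim: l a z => [//|b l IH] a z up /= /andP[ab rl].
apply: (ltn_trans up); apply: (IH b (step a z)) => //.
exact: (jump_up (level_step up) ab).
Qed.

(** A closed path that starts with an ascent would end strictly higher than it
    started. *)
Lemma no_ascent a l z : cycle reduced (a :: l) -> ev (a :: l) z = z ->
  level (step a z) <= level z.
Proof.
rewrite /= rcons_path => /andP[rl _] zl; rewrite leqNgt; apply/negP => up.
by have := ascent up rl; rewrite /= in zl *; rewrite [ev _ _]zl ltnn.
Qed.

(** Every rotation of a closed path is closed, so no step of it ascends, and
    the depth is nonincreasing along the path. *)
Lemma cycle_descent l1 l2 z : cycle reduced (l1 ++ l2) ->
  ev (l1 ++ l2) z = z -> level z <= level (ev l1 z).
Proof.
elim: l2 l1 z => [|a l2 IH] l1 z; first by rewrite cats0 => _ ->.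
move=> cl zl; apply: (leq_trans (IH (rcons l1 a) z _ _)); rewrite ?cat_rcons //.
rewrite -cats1 ev_cat; apply: (@no_ascent _ (l2 ++ l1)).
  by rewrite -cat_cons -(rot_cycle (size l1)) rot_size_cat in cl *.
by rewrite -cat_cons ev_cat -[ev (a :: l2) _]ev_cat zl.
Qed.

(** A closed path that never ascends keeps its depth, and only prescribed steps
    keep the depth. *)
Lemma flat_first a l z : cycle reduced (a :: l) -> ev (a :: l) z = z ->
  exists i, pact z a.1 = pcore (base a.2 i).
Proof.
move=> cl zl.
have /eqP : level (step a z) == level z.
  by rewrite eqn_leq (no_ascent cl) // (@cycle_descent [:: a] l).
rewrite -[level (step a z)]/(depth (jump a.2 (tact (val z) a.1))).
rewrite -(level_act z a.1) => /jump_flat[i zi].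
by exists i; apply: val_inj.
Qed.

(** Elements of G act injectively, so such a [g] maps one pair of base points
    onto the other. *)
Definition links e e' g := forall i, exists j, act (base e i) g = base e' j.

Lemma base_inj e i j : base e i = base e j -> i = j.
Proof. by case: i j => -[] // E; case: (@base_neq e). Qed.

Lemma act_inj g : injective (act^~ g).
Proof.
move=> x y /(congr1 (act^~ g^-1)).
by rewrite -!(proj2 actP) mulgV !(proj1 actP).
Qed.

(** An injection between two-element sets is onto. *)
Lemma links_inv e e' g : links e e' g -> links e' e g^-1.
Proof.
move=> lg k; suff [i <-] : exists i, act (base e i) g = base e' k.
  by exists i; rewrite -(proj2 actP) mulgV (proj1 actP).
have [i Ei] := lg true; have [j Ej] := lg false.
have [<-|] := eqVneq i k; first by exists true.
have [<-|] := eqVneq j k; first by exists false.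
have ij : i <> j by move=> ij; move: Ei; rewrite ij -Ej => /act_inj/base_inj.
by case: (i) (j) (k) ij => -[] [].
Qed.

Lemma links_eq e e' g : links e e' g -> e = e'.
Proof.
case: e e' => -[] // lg; first by case: (base_unlinked lg).
by case: (base_unlinked (links_inv lg)).
Qed.

Lemma links_slot g : links false false g -> slot false g.
Proof. by case/base_stab=> ->; rewrite ?slot1 ?slot_tau. Qed.

(** Otherwise both pairs of base points coincide, and the identity links
    them. *)
Lemma off_base e : exists x, forall i, x <> base e i.
Proof.
apply: contrapT => /forallNP H.
suff /links_eq : links (~~ e) e 1 by case: (e).
move=> i; rewrite (proj1 actP); apply: contrapT => /forallNP Hi.
exact: (H (base (~~ e) i)).
Qed.

(** Two distinct fixed points trace distinct closed paths, which occupy both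
    base points of a pair at every step. *)
Lemma consecutive_links a b l z z' : z' <> z ->
  cycle reduced (a :: b :: l) ->
  ev (a :: b :: l) z = z -> ev (a :: b :: l) z' = z' ->
  links (~~ a.2) b.2 b.1.
Proof.
move=> zz' cl zl zl'.
have image y : ev (a :: b :: l) y = y -> exists i j,
    pact y a.1 = pcore (base a.2 i) /\ act (base (~~ a.2) i) b.1 = base b.2 j.
  move=> yl; have [i yi] := flat_first cl yl; exists i.
  have [||j] := @flat_first b (l ++ [:: a]) (step a y).
  - by rewrite -(rot_cycle 1) /= cats1 in cl *.
  - by rewrite -cat_cons ev_cat -[ev (b :: l) _]/(ev (a :: b :: l) y) yl.
  by rewrite /step yi pjump_core pact_core => -[Ej]; exists j.
have [i [j [zi Ej]]] := image z zl; have [i' [j' [zi' Ej']]] := image z' zl'.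
have ii : i' <> i.
  by move=> E; apply: zz'; apply: (can_inj (pactK a.1)); rewrite zi zi' E.
by move=> k; have [->|/eqP ki] := eqVneq k i; [exists j|exists j'];
  rewrite // -Ej'; congr (act (base _ _) _); case: (k) (i) (i') ki ii => -[] [].
Qed.

Lemma cycle_repeat a l : cycle reduced (a :: l) ->
  cycle reduced (a :: l ++ a :: l ++ a :: l).
Proof.
rewrite /= rcons_path => /andP[rl la].
by rewrite rcons_cat cat_path /= rcons_cat cat_path /= rcons_path rl la.
Qed.

(** Consecutive letters have opposite signs by [consecutive_links] and
    [links_eq], so among two consecutive transitions one preserves the pair of
    [false] and can be cancelled. *)
Lemma cycle_fix1 l z z' : 0 < size l -> z' <> z -> cycle reduced l ->
  ev l z = z -> ev l z' <> z'.
Proof.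
(* Tripling the word provides three consecutive letters even when it is a
   single letter. *)
case: l => // a0 l0 _ zz' /cycle_repeat cl zl zl'.
have ev3 y : ev (a0 :: l0) y = y -> ev (a0 :: l0 ++ a0 :: l0 ++ a0 :: l0) y = y.
  by move=> yl; rewrite -!cat_cons !ev_cat !yl.
move: cl (ev3 _ zl) (ev3 _ zl') => {zl zl' ev3}.
have : 2 < size (a0 :: l0 ++ a0 :: l0 ++ a0 :: l0).
  by rewrite /= size_cat /= size_cat /= !addnS.
case: (a0 :: _) => [|a [|b [|c l]]] // _ cl zl zl'.
have ab := consecutive_links zz' cl zl zl'.
have rab : reduced a b by case/andP: cl.
have [b2|b2] := boolP b.2; last first.
  have a2 := links_eq ab; rewrite a2 (negbTE b2) in ab.
  by move: rab; rewrite /reduced /= a2 (negbTE b2) links_slot.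
have cl' : cycle reduced (b :: c :: l ++ [:: a]).
  by rewrite -(rot_cycle 1) /= cats1 in cl *.
have evb y : ev (a :: b :: c :: l) y = y ->
    ev (b :: c :: l ++ [:: a]) (step a y) = step a y.
  move=> yl; rewrite -!cat_cons ev_cat.
  by rewrite -[ev (b :: _) _]/(ev (a :: b :: c :: l) y) yl.
have zz'a : step a z' <> step a z.
  by move/(can_inj (pjumpK a.2))/(can_inj (pactK a.1)).
have bc := consecutive_links zz'a cl' (evb _ zl) (evb _ zl').
have rbc : reduced b c by case/andP: cl'.
have := links_eq bc; rewrite b2 => c2.
rewrite /reduced /= -c2 b2 /= in rbc; rewrite b2 -c2 in bc.
by rewrite links_slot in rbc.
Qed.

(** The square of a cyclically reduced word is reduced, so it moves a point at
    which its first letter ascends. *)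
Lemma cycle_not_involution l : 0 < size l -> cycle reduced l ->
  ~ forall z, ev l (ev l z) = z.
Proof.
case: l => // a l _; rewrite /= rcons_path => /andP[rl la] H.
have [x xP] := off_base a.2.
pose z := pact (pcore x) a.1^-1.
have up : level z < level (step a z).
  rewrite level_act -[level (step a z)]/(depth (jump a.2 (val (pact z a.1)))).
  rewrite pactVK /jump; case E: (prescribed _ _) => [y|]; last by case: ifP.
  by have [i xi _] := prescribed_coreP E; case: (xP i).
have rll : path reduced a (l ++ a :: l) by rewrite cat_path rl /= la rl.
have := ascent up rll; rewrite -cat_cons ev_cat.
by rewrite [ev _ (ev _ _)]H ltnn.
Qed.

(** New orbits are free, so only the points of [X] matter. *)
Lemma rigid_pact g : rigid_map (pact^~ g).
Proof.
suff g1 z : pact z g = z -> (exists2 y, y <> z & pact y g = y) \/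
    (forall y, pact (pact y g) g = y) -> g = 1.
  by move=> z zg H y; rewrite (g1 z zg H) (proj1 pactP).
have level0 y : pact y g = y -> g = 1 \/ exists2 x, y = pcore x & act x g = x.
  move=> /(congr1 val)/tact_free[]; [by left|move=> [x yx xg]; right].
  by exists x => //; apply: val_inj.
move=> /level0[//|[x -> xg]] [[y yx /level0[//|[x' yx' xg']]]|gg].
  apply: (act_rigid xg); left; exists x' => // E.
  by apply: yx; rewrite yx' E.
apply: (act_rigid xg); right.
have fixgg y : act y (g * g) = y.
  by have := gg (pcore y); rewrite !pact_core -(proj2 actP) => -[].
apply: (act_rigid (fixgg (base true true))); left.
by exists (base true false) => // /esym/base_neq.
Qed.

Lemma not_path a l : ~~ path reduced a l ->
  exists l1 b c l2, a :: l = l1 ++ b :: c :: l2 /\ ~~ reduced b c.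
Proof.
elim: l a => [//|b l IH] a /=; rewrite negb_and.
have [ab /= /IH[l1 [c [d [l2 [-> cd]]]]]|ab _] := boolP (reduced a b).
  by exists (a :: l1), c, d, l2.
by exists [::], a, b, l.
Qed.

Lemma not_cycle l : ~~ cycle reduced l ->
  exists l1 l2 b c l3,
    [/\ l = l1 ++ l2, l2 ++ l1 = b :: c :: l3 & ~~ reduced b c].
Proof.
case: l => // a l /not_path[l1 [b [c [l2 [E bc]]]]].
case/lastP: l2 E => [|l2 d] E.
  rewrite -[[:: b; c]]/([:: b] ++ [:: c]) catA !cats1 -rcons_cons in E.
  have [E' ac] := rcons_inj E; case: l1 {E} E' => [[ab _]|a' l1 [_ El]].
    by move: bc; rewrite -ac -ab reducedxx.
  by exists (a :: l1), [:: b], b, a, l1; rewrite El cats1 ac.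
rewrite -rcons_cons -!rcons_cons -rcons_cat in E.
by have [{}E _] := rcons_inj E; exists l1, (b :: c :: l2), b, c, (l2 ++ l1).
Qed.

(** A word that is not cyclically reduced is conjugate to one with two letters
    less. *)
Lemma rigid_ev l : 0 < size l -> rigid_map (ev l).
Proof.
have [n] := ubnP (size l); elim: n l => // n IH l ln l0.
have [cl z zl [[z' zz' zl']|H]|] := boolP (cycle reduced l).
- by case: (cycle_fix1 l0 zz' cl zl zl').
- by case: (cycle_not_involution l0 cl H).
move/not_cycle => [l1 [l2 [[g e] [[h e'] [l3 [El El' /negPn]]]]]].
move=> /andP[/eqP/= ee sh].
subst e'; rewrite El; apply: rigid_ev_rotate; rewrite El'.
have evE z : ev ((g, e) :: (h, ~~ e) :: l3) z =
    ev l3 (pact z (g * transfer (~~ e) h)).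
  rewrite -[ev _ z]/(ev l3 (step _ (step _ z))); congr (ev l3 _).
  by rewrite /step /= pjump_slot // pjumpK -(proj2 pactP).
have size3 : (size l3).+2 = size l.
  by rewrite El size_cat addnC -size_cat El'.
case: l3 El' evE size3 => [|[k e'] l3] El' evE size3.
  by apply: (@rigid_conj _ id id _ (pact^~ (g * transfer (~~ e) h))) => //;
    exact: rigid_pact.
pose a := (g * transfer (~~ e) h * k, e').
apply: (@rigid_conj _ id id _ (ev (a :: l3))) => //.
  move=> z; rewrite evE -![ev (_ :: _) _]/(ev l3 (step _ _)) /step /=.
  by rewrite (proj2 pactP).
by apply: IH => //; rewrite -ltnS; apply: leq_trans ln; rewrite -size3.
Qed.

(** * The extension of the group *)

Definition family_map (i : G + bool) : point -> point :=
  match i with inl g => pact^~ g | inr e => pjump e end.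

Definition family_inv (i : G + bool) : G + bool :=
  match i with inl g => inl g^-1 | inr e => inr (~~ e) end.

Lemma family_mapK i : cancel (family_map i) (family_map (family_inv i)).
Proof. by case: i => [g|e]; [exact: pactK|exact: pjumpK]. Qed.

Lemma family_mapVK i : cancel (family_map (family_inv i)) (family_map i).
Proof. by case: i => [g|e]; [exact: pactVK|exact: pjumpVK]. Qed.

Definition family := PermFamily family_mapK family_mapVK.

Lemma run_ev (w : seq (pf_index family)) :
  exists l g, forall z, run w z = pact (ev l z) g.
Proof.
elim/last_ind: w => [|w [g|e] [l [h IH]]].
- by exists [::], 1 => z; rewrite (proj1 pactP).
- by exists l, (h * g) => z; rewrite -cats1 run_cat IH (proj2 pactP).
exists (rcons l (h, e)), 1 => z.
by rewrite -!cats1 run_cat ev_cat IH (proj1 pactP).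
Qed.

Lemma rigid_run (w : seq (pf_index family)) : rigid_map (run w).
Proof.
have [l [g wE]] := run_ev w.
case: l wE => [|[h e] l] wE.
  apply: (@rigid_conj _ id id _ (pact^~ g)) => //; exact: rigid_pact.
pose a := (g * h, e).
apply: (rigid_conj (pactVK g) (pactK g) _ (@rigid_ev (a :: l) _)) => //.
move=> z; rewrite wE pactK -![ev (_ :: _) _]/(ev l (step _ _)) /step /=.
by rewrite (proj2 pactP) pactVK.
Qed.

Lemma completion_extension :
  exists (G1 : groupType) (Y : Type) (act1 : Y -> G1 -> Y)
         (iota : {multiplicative G -> G1}) (emb : X -> Y) (f : G1),
    [/\ is_action act1, rigid_action act1, injective emb,
        forall x g, act1 (emb x) (iota g) = emb (act x g) &
        forall i, act1 (emb (base true i)) f = emb (base false i)].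
Proof.
pose gen i := @of_word _ family [:: i].
have genM : {morph (fun g => gen (inl g)) : g h / g * h}.
  move=> g h; apply: generated_eq => z.
  by rewrite [RHS]generated_mulE /= (proj2 pactP).
pose iota := HB.pack_for {multiplicative G -> generated family}
  (fun g => gen (inl g)) (isMultiplicative.Build _ _ _ genM).
exists (generated family), point, (fun z (p : generated family) => p z).
exists iota, pcore, (gen (inr true)).
split.
- exact: generated_action.
- exact: generated_rigid rigid_run.
- by move=> x y [].
- by move=> x g; exact: pact_core.
- by move=> i; exact: pjump_core.
Qed.

End FreeCompletion.

(** Whether [f] must intertwine [t] with an element of G depends on whether some
    [s] exchanges [y1] and [y2]; such an [s] is unique by rigidity. *)
Theorem rigid_extension (G : groupType) (X : Type) (act : X -> G -> X)
    (t : G) (x y1 y2 : X) :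
  is_action act -> rigid_action act -> involution t -> y1 <> y2 ->
  exists (G1 : groupType) (Y : Type) (act1 : Y -> G1 -> Y)
         (iota : {multiplicative G -> G1}) (emb : X -> Y) (f : G1),
    [/\ is_action act1, rigid_action act1, injective emb,
        forall x g, act1 (emb x) (iota g) = emb (act x g) &
        act1 (emb x) f = emb y1 /\ act1 (emb (act x t)) f = emb y2].
Proof.
move=> actP rig [t1 t2] y12.
have tt : t * t = 1 by rewrite -expg2.
have xtt : act (act x t) t = x by rewrite -(proj2 actP) tt (proj1 actP).
have inv_free z g : g <> 1 -> g * g = 1 -> act z g <> z.
  by move=> g1 gg zg; apply: g1; apply: (rig _ _ zg); right.
have [[g [xg xtg]]|unlinked] :=
    pselect (exists g, act x g = y1 /\ act (act x t) g = y2).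
  by exists G, X, act, (idfun : {multiplicative G -> G}), id, g; split.
pose base e i :=
  if e then (if i then x else act x t) else (if i then y1 else y2).
have base_unlinked g : ~ forall i, exists j, act (base true i) g = base false j.
  move=> lg; have [/= i xg] := lg true; have [/= j xtg] := lg false.
  have act_inj : act (act x t) g <> act x g.
    move=> /(congr1 (act^~ g^-1)); rewrite -!(proj2 actP) mulgV mulg1.
    by rewrite (proj1 actP); exact: inv_free.
  case: i j xg xtg => -[] xg xtg; rewrite ?xg ?xtg // in act_inj.
    by apply: unlinked; exists g.
  (* [t] exchanges the two points, so a link in the wrong order can be
     corrected. *)
  by apply: unlinked; exists (t * g); rewrite !(proj2 actP) xtt.
have [tau [tau2 tau1 base_tau base_stab]] : exists tau : bool -> G,
  [/\ forall e, tau e * tau e = 1, forall e, tau e = 1 -> tau (~~ e) = 1,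
     forall e i, tau e <> 1 -> act (base e i) (tau e) = base e (~~ i) &
     forall g, (forall i, exists j, act (base false i) g = base false j) ->
       g = 1 \/ g = tau false].
  have stab_cases g :
      (forall i, exists j, act (base false i) g = base false j) ->
      g = 1 \/ act y1 g = y2 /\ act y2 g = y1.
    move=> gP; have [/= i gi] := gP true; have [/= j gj] := gP false.
    case: i gi => g1; case: j gj => g2; [|left|by right|].
    - by case: (y12); apply: (act_inj actP (g := g)); rewrite g1.
    - by apply: (rig _ _ g1); left; exists y2 => // /esym.
    - by case: (y12); apply: (act_inj actP (g := g)); rewrite g1.
  have [[s [s12 s21]]|noswap] :=
    pselect (exists s, act y1 s = y2 /\ act y2 s = y1).
    have s1 : s <> 1 by move=> s1; rewrite s1 (proj1 actP) in s12.
    have ss : s * s = 1.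
      apply: (rig y1); first by rewrite (proj2 actP) s12.
      by left; exists y2; [exact/nesym|rewrite (proj2 actP) s21].
    exists (fun e => if e then t else s).
    split=> [[]//|[]//|[] []//=|g /stab_cases[|[g12 g21]]]; [by left|right].
    apply: (mulIg s); rewrite ss; apply: (rig y1).
      by rewrite (proj2 actP) g12.
    by left; exists y2; [exact/nesym|rewrite (proj2 actP) g21].
  exists (fun=> 1); split=> // [e|g /stab_cases[]]; [by rewrite mulg1|by left|].
  by move=> H; case: noswap; exists g.
have base_neq e : base e true <> base e false.
  by case: e => //= /esym; exact: inv_free.
have [G1 [Y [act1 [iota [emb [f [H1 H2 H3 H4 H5]]]]]]] :=
  completion_extension actP rig tau2 tau1 base_neq base_tau base_unlinked
    base_stab.
exists G1, Y, act1, iota, emb, f; split=> //.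
by split; [exact: (H5 true)|exact: (H5 false)].
Qed.

(** * Malnormal subgroups as point stabilizers *)

Lemma subgroupP (G : groupType) (A : set G) : subgroup A <->
  [/\ A 1, forall a, A a -> A a^-1 & forall a b, A a -> A b -> A (a * b)].
Proof.
split=> [sA|[A1 AV AM]].
  split; first by case: sA => /set_mem.
    by move=> a /mem_set/(group_closedV sA)/set_mem.
  by move=> a b /mem_set Aa /mem_set /(group_closedM sA Aa)/set_mem.
split; first exact: mem_set.
by move=> a b /set_mem Aa /set_mem Ab; apply/mem_set/AM => //; exact: AV.
Qed.

Lemma right_cosetE (G : groupType) (A : set G) g x :
  right_coset A g x <-> A (x * g^-1).
Proof.
split=> [[a Aa <-]|Axg]; first by rewrite mulgK.
by exists (x * g^-1); rewrite ?mulgVK.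
Qed.

Lemma right_coset_eq (G : groupType) (A : set G) g h : subgroup A ->
  right_coset A g = right_coset A h <-> A (g * h^-1).
Proof.
move=> /subgroupP[A1 AV AM]; split=> [E|Agh].
  by apply/right_cosetE; rewrite -E; apply/right_cosetE; rewrite mulgV.
apply/seteqP; split=> x /right_cosetE Ax; apply/right_cosetE.
  by rewrite -[x](mulgVK g) -mulgA; exact: AM.
rewrite -[x](mulgVK h) -mulgA; apply: AM => //.
by have := AV _ Agh; rewrite invgM invgK.
Qed.

Lemma conj_setE (G : groupType) (A : set G) g x :
  conj_set A g x <-> A (g * x * g^-1).
Proof.
split=> [[a Aa <-]|Ax]; first by rewrite conjgE !mulgA mulgV mul1g mulgK.
by exists (g * x * g^-1); rewrite // conjgE !mulgA mulVg mul1g mulgVK.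
Qed.

Section Cosets.
Variables (G : groupType) (A : set G).

Definition coset_space := {B : set G | exists g, B = right_coset A g}.

Definition coset g : coset_space := exist _ _ (ex_intro _ g erefl).

Lemma coset_act_subproof (B : coset_space) g :
  exists h, [set b * g | b in sval B] = right_coset A h.
Proof.
have [h ->] := svalP B; exists (h * g).
by rewrite /right_coset image_comp; apply: eq_imagel => a _ /=; rewrite mulgA.
Qed.

Definition coset_act (B : coset_space) g : coset_space :=
  exist _ _ (coset_act_subproof B g).

Lemma coset_eq g h : subgroup A -> coset g = coset h <-> A (g * h^-1).
Proof.
move=> sA; split=> [[] /right_coset_eq -/(_ sA) //|/right_coset_eq E].
by apply: eq_exist; exact: E.
Qed.

Lemma coset_surj (B : coset_space) : exists g, B = coset g.
Proof.
by have [g E] := svalP B; exists g; case: B E => B BP E; exact: eq_exist.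
Qed.

Lemma coset_actE g h : coset_act (coset g) h = coset (g * h).
Proof.
apply: eq_exist.
by rewrite /right_coset image_comp; apply: eq_imagel => a _ /=; rewrite mulgA.
Qed.

Lemma coset_actP : is_action coset_act.
Proof.
by split=> [B|B g h]; have [k ->] := coset_surj B;
  rewrite !coset_actE ?mulg1 ?mulgA.
Qed.

(** If [g] fixes the cosets of [h] and [k], then [h * g * h^-1] lies in [A] and
    in its conjugate by [k * h^-1]. *)
Lemma coset_rigid : malnormal A -> involution_free A -> rigid_action coset_act.
Proof.
move=> [sA _ mA] iA B g; have [h ->] := coset_surj B.
rewrite coset_actE => /coset_eq -/(_ sA) Ag.
move=> H; suff : h * g * h^-1 = 1.
  move/(canRL (mulgVK h)); rewrite mul1g => /(canRL (mulKg h)).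
  by rewrite mulVg.
case: H => [[C]|gg]; last first.
  apply: contrapT => a1; apply: (iA _ Ag); split=> //.
  by rewrite expg2 -!mulgA mulKg [g * (g * _)]mulgA gg mul1g mulgV.
have [k ->] := coset_surj C; rewrite coset_actE => kh /coset_eq -/(_ sA) Akg.
have nA : ~ A (k * h^-1) by move=> /coset_eq -/(_ sA).
have : (A `&` conj_set A (k * h^-1)) (h * g * h^-1).
  split=> //; apply/conj_setE; rewrite invgM invgK.
  by rewrite -!mulgA mulKg mulKg !mulgA.
by rewrite mA.
Qed.

End Cosets.

Section Stabilizer.
Variables (G : groupType) (X : Type) (act : X -> G -> X).
Hypothesis actP : is_action act.

Definition stabilizer x : set G := [set g | act x g = x].

Lemma stabilizer_subgroup x : subgroup (stabilizer x).
Proof.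
apply/subgroupP; split; rewrite /stabilizer /=; first exact: (proj1 actP).
  by move=> a ax; rewrite -{1}ax -(proj2 actP) mulgV (proj1 actP).
by move=> a b ax bx; rewrite (proj2 actP) ax.
Qed.

Lemma stabilizer_coset x g h : act x g = act x h ->
  right_coset (stabilizer x) g = right_coset (stabilizer x) h.
Proof.
move=> E; apply/(right_coset_eq _ _ (stabilizer_subgroup x)).
by rewrite /stabilizer /= (proj2 actP) E -(proj2 actP) mulgV (proj1 actP).
Qed.

(** A nontrivial element of the stabilizer and of its conjugate by [h] would fix
    both [x] and [act x h]. *)
Lemma stabilizer_malnormal x g : rigid_action act -> act x g <> x ->
  malnormal (stabilizer x) /\ involution_free (stabilizer x).
Proof.
move=> rig xg; split; last first.
  by move=> a ax [a1]; rewrite expg2 => aa; apply/a1/(rig x) => //; right.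
have sX := stabilizer_subgroup x.
split=> //; first by split=> // /(_ g I).
move=> h xh; apply/seteqP; split=> [a [ax /conj_setE axh]|_ ->]; last first.
  have [S1 _ _] := (subgroupP (stabilizer x)).1 sX.
  by split=> //; apply/conj_setE; rewrite mulg1 mulgV.
apply: (rig x) => //; left; exists (act x h) => //.
by move/(congr1 (act^~ h)): axh; rewrite -!(proj2 actP) mulgVK.
Qed.

End Stabilizer.

Theorem theorem1p1 (G : groupType) (A : set G) (t : G)
    (malA : malnormal A) (inv_t : involution t) (tNA : ~ A t)
    (A_noinv : involution_free A) (u v : G)
    (uv : right_coset A u <> right_coset A v) :
  exists (G1 : groupType) (iota : {multiplicative G -> G1}) (A1 : set G1)
         (f : G1),
    [/\ injective iota,
        malnormal A1 /\ involution_free A1,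
        A1 `&` range iota = iota @` A,
        right_coset A1 f = right_coset A1 (iota u) &
        right_coset A1 (iota t * f) = right_coset A1 (iota v)].
Proof.
have sA : subgroup A by case: malA.
have uv' : coset A u <> coset A v by case.
have [G1 [Y [act1 [iota [emb [f [actP rig emb_inj embE [fu fv]]]]]]]] :=
  rigid_extension (coset A 1) (coset_actP A) (coset_rigid malA A_noinv)
    inv_t uv'.
have actE g : act1 (emb (coset A 1)) (iota g) = emb (coset A g).
  by rewrite embE coset_actE mul1g.
have stabE g : stabilizer act1 (emb (coset A 1)) (iota g) <-> A g.
  rewrite /stabilizer /= actE; split=> [/emb_inj/coset_eq -/(_ sA)|Ag].
    by rewrite invg1 mulg1.
  by congr emb; apply/coset_eq; rewrite ?invg1 ?mulg1.
have iota1 : iota 1 = 1.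
  by apply: (mulgI (iota 1)); rewrite -gmulfM !mulg1.
exists G1, iota, (stabilizer act1 (emb (coset A 1))), f; split.
- move=> g h gh; apply: (mulIg h^-1); rewrite mulgV.
  have gh1 k : coset_act (coset A k) (g * h^-1) = coset A k.
    apply: emb_inj; rewrite -embE gmulfM gh -gmulfM mulgV iota1.
    exact: (proj1 actP).
  apply: (coset_rigid malA A_noinv (gh1 u)).
  by left; exists (coset A v) => //; exact/nesym.
- by apply: (@stabilizer_malnormal _ _ _ actP _ (iota t) rig) => /stabE.
- apply/seteqP; split=> [_ [/[swap] [[g _ <-]] /stabE Ag]|_ [g Ag <-]].
    by exists g.
  by split; [apply/stabE|exists g].
- by apply: stabilizer_coset => //; rewrite fu actE.
- apply: stabilizer_coset => //.
  by rewrite (proj2 actP) embE fv actE.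
Qed.
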